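(* Let $n$ be a primitive non-deficient number with prime factorization $n=p_1^{a_1}p_2^{a_2}\cdots p_k^{a_k}$, where $p_1<\cdots<p_k$ are primes and all $a_i\ge 1$. Assume that there is an index $t$ such that $a_t$ is odd and $a_i$ is even for all $i\ne t$. Assume further that $\frac{p_t+2}{2}\geq p_1\geq 11$. Then $$T(n)<\log 2-\frac{11}{50p_1^2}.$$
   Context: $\sigma(n)$ denotes the sum of the positive divisors of $n$. A positive integer $n$ is non-deficient if $\sigma(n)/n\ge 2$. A primitive non-deficient number is a non-deficient number having no proper divisor that is non-deficient. For a positive integer $n$, $T(n)=\sum_{p\mid n}\frac1p$, where $p$ runs over the distinct prime divisors of $n$. $\log$ is the natural logarithm. *)

(* Defs.v *)
From mathcomp Require Import all_boot all_order all_algebra.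
From mathcomp Require Import reals.

Set Implicit Arguments.
Unset Strict Implicit.
Unset Printing Implicit Defensive.

Import Order.TTheory GRing.Theory Num.Theory.
Local Open Scope ring_scope.

Definition sigma (n : nat) : nat := (\sum_(d <- divisors n) d)%N.

Definition nondeficient (n : nat) : Prop :=
  (0 < n)%N /\ 2 <= (sigma n)%:R / n%:R :> rat.

Definition primitive_nondeficient (n : nat) : Prop :=
  nondeficient n /\
  (forall d : nat, (d %| n)%N -> d <> n -> ~ nondeficient d).

Definition T {R : realType} (n : nat) : R := \sum_(p <- primes n) p%:R^-1.

(* Main.v *)
(* By primitivity every [n / p_j] is deficient, so with [x_i = 1 / p_i] the sum
   over [i] of [ln (1 + x_i + ... + x_i ^ b_i)] is less than [ln 2], where [b_i]
   is the exponent of [p_i] in [n / p_j].  A summand is at least [x_i] when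
   [b_i >= 2], and at least [x_i - x_i ^ 2 / 2] in any case; the latter bound is
   needed only for [i = t] and [i = j].  These two losses are outweighed by the
   gain [x_1 ^ 2 / 2 - 2 / 3 * x_1 ^ 3] of the smallest prime, because
   [p_t >= 2 p_1 - 1] by hypothesis and [j] can be chosen with
   [p_j >= 3 p_1 - 4]: non-deficiency forces [n] to have at least [p_1] distinct
   prime divisors, all of them odd. *)
Require Import Defs.
From mathcomp Require Import all_boot all_order all_algebra ring lra zify.
From mathcomp Require Import topology normedtype derive realfun reals exp.

Set Implicit Arguments.
Unset Strict Implicit.
Unset Printing Implicit Defensive.

Import Order.TTheory GRing.Theory Num.Theory.
Import numFieldNormedType.Exports.
Local Open Scope ring_scope.

(** * Multiplicativity of the divisor sum, and the abundancy as an Euler product *)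

Lemma gcdn_mul_coprime m n d : coprime m n -> (d %| m * n)%N ->
  (gcdn d m * gcdn d n)%N = d.
Proof.
move=> co_mn d_mn; apply/eqP; rewrite eqn_dvd; apply/andP; split.
  rewrite Gauss_dvd ?dvdn_gcdl//.
  exact: coprime_dvdl (dvdn_gcdr _ _) (coprime_dvdr (dvdn_gcdr _ _) co_mn).
rewrite muln_gcdl dvdn_gcd dvdn_mulr//= muln_gcdr dvdn_gcd d_mn andbT.
exact: dvdn_mull.
Qed.

(** Multiplication maps pairs of divisors of [m] and [n] bijectively onto the divisors of [m * n];
    the inverse sends [d] to [(gcdn d m, gcdn d n)]. *)
Lemma sigma_coprimeM m n : (0 < m)%N -> (0 < n)%N -> coprime m n ->
  sigma (m * n) = (sigma m * sigma n)%N.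
Proof.
move=> m0 n0 co_mn; rewrite /sigma big_distrlr /=.
transitivity (\sum_(d <- [seq d * e | d <- divisors m, e <- divisors n]) d)%N;
  last by rewrite big_allpairs_dep.
apply: perm_big; apply: uniq_perm; first exact: divisors_uniq.
  apply: allpairs_uniq; rewrite ?divisors_uniq// => -[d e] [d' e'].
  move=> /allpairsP[[? ?] [/= + + [-> ->]]] /allpairsP[[? ?] [/= + + [-> ->]]].
  rewrite -!dvdn_divisors// => dm en dm' en' /= eq_de.
  have gl u v : (u %| m)%N -> (v %| n)%N -> gcdn m (u * v) = u.
    by move=> um vn; rewrite Gauss_gcdl ?(coprime_dvdr vn)//; apply/gcdn_idPr.
  have gr u v : (u %| m)%N -> (v %| n)%N -> gcdn n (u * v) = v.
    move=> um vn; rewrite Gauss_gcdr ?(coprime_dvdr um)// 1?coprime_sym//.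
    exact/gcdn_idPr.
  by rewrite -(gl _ _ dm en) -{2}(gr _ _ dm en) eq_de gl// gr.
move=> d; rewrite -dvdn_divisors ?muln_gt0 ?m0//.
apply/idP/allpairsP => [d_mn|[[u v] [/= + + ->]]].
  exists (gcdn d m, gcdn d n); rewrite -!dvdn_divisors//= !dvdn_gcdr.
  by rewrite gcdn_mul_coprime.
by rewrite -!dvdn_divisors//; exact: dvdn_mul.
Qed.

Lemma sigma_pfactor p e : prime p -> sigma (p ^ e) = (\sum_(i < e.+1) p ^ i)%N.
Proof.
move=> p_pr; rewrite /sigma -(big_mkord xpredT (expn p)) /index_iota subn0.
rewrite -[RHS](big_map (expn p) xpredT id).
apply: perm_big; apply: uniq_perm; first exact: divisors_uniq.
  rewrite map_inj_uniq ?iota_uniq//; exact: expnI (prime_gt1 p_pr).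
move=> d; rewrite -dvdn_divisors ?expn_gt0 ?prime_gt0//.
apply/(dvdn_pfactor _ _ p_pr)/mapP => -[i].
  by move=> ie ->; exists i; rewrite ?mem_iota.
by rewrite mem_iota => /= ? ->; exists i.
Qed.

Lemma sigma_prod (I : eqType) (r : seq I) (p a : I -> nat) :
  uniq r -> (forall i, prime (p i)) -> injective p ->
  sigma (\prod_(i <- r) p i ^ a i) = (\prod_(i <- r) sigma (p i ^ a i))%N.
Proof.
move=> + p_pr p_inj; elim: r => [|i r IHr] /=.
  by rewrite !big_nil /sigma big_seq1.
move=> /andP[ir ur]; rewrite !big_cons -IHr// sigma_coprimeM//.
- by rewrite expn_gt0 prime_gt0.
- by rewrite prodn_gt0 // => j; rewrite expn_gt0 prime_gt0.
rewrite big_seq; elim/big_rec: _ => [|j m jr co_m]; first by rewrite coprimen1.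
rewrite coprimeMr co_m andbT; apply/coprimeXl/coprimeXr.
by rewrite prime_coprime// dvdn_prime2//; apply: contra ir => /eqP/p_inj ->.
Qed.

(** At [x = 1 / p] with [p] prime, this is the abundancy of [p ^ a]. *)
Definition geom (R : pzRingType) (x : R) (a : nat) : R :=
  \sum_(e < a.+1) x ^+ e.

Lemma abundancy_prod (F : numFieldType) (I : finType) (p a : I -> nat) :
  (forall i, prime (p i)) -> injective p ->
  (sigma (\prod_i p i ^ a i))%:R / (\prod_i p i ^ a i)%:R
  = \prod_i geom (p i)%:R^-1 (a i) :> F.
Proof.
move=> p_pr p_inj; rewrite sigma_prod ?index_enum_uniq// !natr_prod -prodf_div.
apply: eq_bigr => i _; rewrite sigma_pfactor// natr_sum mulr_suml /geom.
have pi_neq0 : (p i)%:R != 0 :> F by rewrite pnatr_eq0 -lt0n prime_gt0.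
(* Dividing by [p i ^ a i] turns the powers of [p i] into those of its inverse in reverse order. *)
rewrite (reindex_inj rev_ord_inj); apply: eq_bigr => e _ /=.
have ea : (e <= a i)%N by rewrite -ltnS.
rewrite subSS !natrX exprB ?unitfE// mulrAC divff ?expf_neq0//.
by rewrite mul1r exprVn.
Qed.

Lemma nondeficientE n : nondeficient n <-> (0 < n)%N /\ (2 * n <= sigma n)%N.
Proof.
rewrite /nondeficient; split=> -[n0]; split=> //; move: b;
  by rewrite ler_pdivlMr ?ltr0n// -natrM ler_nat.
Qed.

Lemma T_prod (R : realType) (I : finType) (p a : I -> nat) :
  (forall i, prime (p i)) -> injective p -> (forall i, (0 < a i)%N) ->
  T (\prod_i p i ^ a i) = \sum_i (p i)%:R^-1 :> R.
Proof.
move=> p_pr p_inj a0; rewrite /T -(big_map p xpredT (fun q => q%:R^-1)).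
apply: perm_big; apply: uniq_perm; first exact: primes_uniq.
  by rewrite map_inj_uniq ?index_enum_uniq.
move=> q; rewrite mem_primes prodn_gt0 => [|i]; last first.
  by rewrite expn_gt0 prime_gt0.
apply/andP/mapP => [[q_pr]|[i _ ->]].
  rewrite Euclid_dvd_prod// big_has => /hasP[i _].
  rewrite Euclid_dvdX// a0 andbT dvdn_prime2// => /eqP ->.
  by exists i; rewrite ?mem_index_enum.
by rewrite p_pr /= (bigD1 i)//= dvdn_mulr// dvdn_exp.
Qed.

(** * Bounds for truncated geometric sums and their logarithms *)

Lemma ln1Dx_ge_taylor4 (R : realType) (x : R) : 0 <= x ->
  x - x ^+ 2 / 2 + x ^+ 3 / 3 - x ^+ 4 / 4 <= ln (1 + x).
Proof.
move=> x0.
pose f (y : R) : R :=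
  ln (1 + y) - (y - 2^-1 * y ^+ 2 + 3^-1 * y ^+ 3 - 4^-1 * y ^+ 4).
(* The quartic has derivative [1 - y + y ^+ 2 - y ^+ 3], which is [(1 - y ^+ 4) / (1 + y)]; hence
   [f] is nondecreasing from [f 0 = 0]. *)
have df (y : R) : -1 < y -> is_derive y (1 : R) f (y ^+ 4 / (1 + y)).
  move=> y1; have ln_y : is_derive (1 + y) (1 : R) (@ln R) (1 + y)^-1.
    by apply: is_derive1_ln; rewrite -ltrBlDl sub0r.
  have y1_neq0 : 1 + y != 0 by apply/eqP => ?; lra.
  have ln1D_y : is_derive y (1 : R) (fun z : R => ln (1 + z)) (1 + y)^-1.
    have := is_derive1_comp (g := fun z : R => 1 + z) ln_y.
    move=> /(_ 1); rewrite mulr1; apply.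
    by apply: is_derive_eq; rewrite add0r mulr1.
  apply: is_derive_eq; rewrite /GRing.scale /=.
  by field.
have f_derivable (y : R) : -1 < y -> derivable f y 1 by move=> /df[].
have : f 0 <= f x.
  apply: (@ger0_derive1_ndecr R f 0 x) => //.
  - by move=> y; rewrite in_itv/= => /andP[y0 _]; apply: f_derivable; lra.
  - move=> y; rewrite in_itv/= => /andP[y0 _]; rewrite derive1E.
    have [_ ->] : is_derive y (1 : R) f (y ^+ 4 / (1 + y)) by apply: df; lra.
    by rewrite divr_ge0 ?exprn_ge0//; lra.
  apply: derivable_within_continuous => y; rewrite in_itv/= => /andP[y0 _].
  by apply: f_derivable; lra.
rewrite /f addr0 ln1 !expr0n /= !mulr0 !subr0 addr0 subrr subr_ge0.
by move=> /(le_trans _); apply; lra.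
Qed.

Lemma geom_lt (F : realFieldType) (x : F) a :
  0 < x < 1 -> geom x a < (1 - x)^-1.
Proof.
move=> /andP[x0 x1]; rewrite -[ltRHS]mul1r ltr_pdivlMr ?subr_gt0// mulrC.
have -> : (1 - x) * geom x a = 1 - x ^+ a.+1.
  by rewrite -[1 - x]opprB mulNr -subrX1 opprB.
by rewrite gtrBl exprn_gt0.
Qed.

Lemma geom_ge1Dx (F : numDomainType) (x : F) a :
  0 <= x -> (1 <= a)%N -> 1 + x <= geom x a.
Proof.
case: a => // a x0 _; rewrite /geom !big_ord_recl expr0 expr1 addrA lerDl.
by apply: sumr_ge0 => i _; exact: exprn_ge0.
Qed.

Lemma geom_ge1DxDx2 (F : numDomainType) (x : F) a :
  0 <= x -> (2 <= a)%N -> 1 + (x + x ^+ 2) <= geom x a.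
Proof.
case: a => [//|[//|a]] x0 _.
rewrite /geom !big_ord_recl expr0 expr1 !addrA lerDl.
by apply: sumr_ge0 => i _; exact: exprn_ge0.
Qed.

(** Each factor is below [p i / (p i - 1)], hence below [(c + i + 1) / (c + i)], and these quotients
    telescope. This will force a non-deficient number to have many prime divisors. *)
Lemma prod_geom_lt (F : realFieldType) (m c : nat) (p a : 'I_m.+1 -> nat) :
  (0 < c)%N -> (forall i : 'I_m.+1, (c + i < p i)%N) ->
  \prod_i geom (p i)%:R^-1 (a i) < (c + m.+1)%:R / c%:R :> F.
Proof.
move=> c0 cp.
have -> : (c + m.+1)%:R / c%:R
    = \prod_(i < m.+1) ((c + i).+1%:R / (c + i)%:R) :> F.
  rewrite -(big_mkord xpredT (fun i => (c + i).+1%:R / (c + i)%:R)).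
  rewrite (@telescope_prodf_eq F _ _ (fun i => (c + i)%:R)) => [|i _||i _];
    by rewrite ?addn0 ?addnS// pnatr_eq0 addn_eq0 negb_and -lt0n c0.
apply: ltr_prod => [|i _].
  by apply/hasP; exists ord0; rewrite ?mem_index_enum.
have ci0 : 0 < (c + i)%:R :> F by rewrite ltr0n addn_gt0 c0.
have pi_ge : (c + i)%:R + 1 <= (p i)%:R :> F by rewrite natr1 ler_nat.
have pi0 : 0 < (p i)%:R :> F by lra.
rewrite sumr_ge0 => [|e _]; last by rewrite exprn_ge0// invr_ge0 ltW.
apply: lt_le_trans (geom_lt _ _) _.
  by rewrite invr_gt0 pi0 invf_lt1//; lra.
have -> : 1 - (p i)%:R^-1 = ((p i)%:R - 1) / (p i)%:R :> F by field; lra.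
rewrite invf_div ler_pdivrMr; last by lra.
by rewrite mulrAC ler_pdivlMr// -natr1; nra.
Qed.

Lemma ln_geom_ge1 (R : realType) (x : R) a :
  0 <= x <= 1 -> (1 <= a)%N -> x - x ^+ 2 / 2 <= ln (geom x a).
Proof.
move=> /andP[x0 x1] a1; apply: le_trans (_ : ln (1 + x) <= _); last first.
  by have ge_a := geom_ge1Dx x0 a1; rewrite ler_ln ?posrE//; lra.
by apply: le_trans (ln1Dx_ge_taylor4 x0); nra.
Qed.

Lemma ln_geom_ge2 (R : realType) (x : R) a : 0 <= x <= 11^-1 -> (2 <= a)%N ->
  x + x ^+ 2 / 2 - 2 / 3 * x ^+ 3 <= ln (geom x a).
Proof.
move=> /andP[x0 x1] a2.
have w0 : 0 <= x + x ^+ 2 by rewrite addr_ge0 ?exprn_ge0.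
apply: le_trans (_ : ln (1 + (x + x ^+ 2)) <= _); last first.
  by have ge_a := geom_ge1DxDx2 x0 a2; rewrite ler_ln ?posrE//; lra.
apply: le_trans (ln1Dx_ge_taylor4 w0); rewrite -subr_ge0.
set d := (X in 0 <= X).
(* In the quartic bound at [x + x ^+ 2], the terms up to degree 3 are the claimed ones and that of
   degree 5 cancels. *)
have -> : d = x ^+ 4 * (4^-1 - 7 / 6 * x ^+ 2 - x ^+ 3 - x ^+ 4 / 4).
  by rewrite /d; field.
have xX n : x ^+ n.+1 <= 11^-1.
  by rewrite exprS (le_trans _ x1)// ler_piMr// exprn_ile1//; lra.
by rewrite mulr_ge0 ?exprn_ge0//; move: (xX 1) (xX 2) (xX 3); lra.
Qed.

Lemma ln_prod (R : realType) (I : Type) (r : seq I) (f : I -> R) :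
  (forall i, 0 < f i) -> ln (\prod_(i <- r) f i) = \sum_(i <- r) ln (f i).
Proof.
move=> f0; elim: r => [|i r IHr]; first by rewrite !big_nil ln1.
by rewrite !big_cons lnM ?IHr// posrE// prodr_gt0.
Qed.

(** For [u], [v], [w] the inverses of the smallest prime, [p t] and [p j]. In units of [u ^+ 2], the
    right side is at least [1/2 - 2/33 - (11/21)^2/2 - (11/29)^2/2], about 0.230, against 0.22 on
    the left. *)
Lemma quadratic_balance (F : realFieldType) (u v w : F) :
  0 < u -> 0 < v -> 0 < w -> u <= 11^-1 -> v <= 11 / 21 * u ->
  w <= 11 / 29 * u ->
  11 / 50 * u ^+ 2 < u ^+ 2 / 2 - 2 / 3 * u ^+ 3 - v ^+ 2 / 2 - w ^+ 2 / 2.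
Proof.
move=> u0 v0 w0 u11 vu wu.
have v2 : v ^+ 2 <= (11 / 21) ^+ 2 * u ^+ 2.
  by rewrite -exprMn ler_sqr ?nnegrE; lra.
have w2 : w ^+ 2 <= (11 / 29) ^+ 2 * u ^+ 2.
  by rewrite -exprMn ler_sqr ?nnegrE; lra.
have u3 : u ^+ 3 <= 11^-1 * u ^+ 2.
  by rewrite exprS ler_wpM2r ?exprn_ge0//; lra.
have u2 : 0 < u ^+ 2 by rewrite exprn_gt0.
by lra.
Qed.

Theorem proposition5 (R : realType) (n k : nat)
    (p a : 'I_k.+1 -> nat) (t : 'I_k.+1)
    (n_pnd : primitive_nondeficient n)
    (p_prime : forall i, prime (p i))
    (p_incr : forall i j : 'I_k.+1, (i < j)%N -> (p i < p j)%N)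
    (a_ge1 : forall i, (1 <= a i)%N)
    (n_fact : n = (\prod_(i < k.+1) p i ^ a i)%N)
    (at_odd : odd (a t))
    (a_even : forall i, i != t -> ~~ odd (a i))
    (pt_ge : (p ord0)%:R <= ((p t)%:R + 2) / 2 :> R)
    (p1_ge : (11 <= p ord0)%N) :
  T n < ln 2 - 11 / (50 * (p ord0)%:R ^+ 2) :> R.
Proof.
have p_inj : injective p.
  move=> i j eq_p; apply/val_inj.
  by case: (ltngtP i j) => // /p_incr; rewrite eq_p ltnn.
have p0_min i : (p ord0 <= p i)%N.
  case: (posnP i) => [i0|/(p_incr ord0)/ltnW//].
  by rewrite (_ : i = ord0)//; apply: val_inj.
have p_odd i : odd (p i).
  by have := p0_min i; case: (even_prime (p_prime i)) => [->|//]; lia.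
have p_ge (i : 'I_k.+1) : (p ord0 + 2 * i <= p i)%N.
  case: i => i; elim: i => [|i IHi] lt_ik.
    by rewrite muln0 addn0.
  have lt_i : (i < k.+1)%N by exact: ltnW.
  have := IHi lt_i; have := p_incr (Ordinal lt_i) (Ordinal lt_ik) (ltnSn i).
  by move: (p_odd (Ordinal lt_i)) (p_odd (Ordinal lt_ik)) => /=; lia.
have [/nondeficientE[n0 sigma_n] n_min] := n_pnd.
(* With [c = p ord0 - 1], the abundancy is at least 2 and below [(c + k.+1) / c], so [c < k.+1]. *)
have k_ge : (p ord0 <= k.+1)%N.
  have : \prod_i geom (p i)%:R^-1 (a i)
      < ((p ord0).-1 + k.+1)%:R / (p ord0).-1%:R :> R.
    apply: prod_geom_lt => [|i]; first by lia.
    by have := p_ge i; lia.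
  rewrite -abundancy_prod// -n_fact => /(le_lt_trans _) => /(_ 2).
  rewrite ler_pdivlMr ?ltr0n// -natrM ler_nat => /(_ sigma_n).
  rewrite ltr_pdivlMr ?ltr0n; last by lia.
  by rewrite -natrM ltr_nat; lia.
(* The last index serves, or the one before it if [t] is last; [p_ge] at [k.-1] gives
   [p ord0 + 2 * (p ord0 - 2)]. *)
have [j jt pj_ge] : exists2 j, j != t & (3 * p ord0 <= p j + 4)%N.
  have [->|t_max] := eqVneq t ord_max; last first.
    by exists ord_max; rewrite 1?eq_sym//; have := p_ge ord_max => /=; lia.
  have lt_k : (k.-1 < k.+1)%N by lia.
  exists (Ordinal lt_k); first by rewrite -val_eqE /=; lia.
  by have := p_ge (Ordinal lt_k) => /=; lia.
(* The hypothesis gives [2 * p ord0 - 2] as a lower bound, and parity of [p t] gains one more. *)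
have {}pt_ge : (2 * p ord0 <= p t + 1)%N.
  have : (2 * p ord0 <= p t + 2)%N.
    by rewrite -(ler_nat R) natrM natrD; lra.
  by have := p_odd t; lia.
have t_neq0 : t != ord0 by apply/eqP => t0; move: pt_ge; rewrite t0; lia.
have j_neq0 : j != ord0 by apply/eqP => j0; move: pj_ge; rewrite j0; lia.
pose b i := (a i - (i == j))%N.
pose m := (\prod_i p i ^ b i)%N.
have m0 : (0 < m)%N by rewrite prodn_gt0// => i; rewrite expn_gt0 prime_gt0.
have n_m : n = (m * p j)%N.
  have -> : p j = (\prod_i p i ^ (i == j))%N.
    by rewrite (bigD1 j)//= eqxx big1 ?muln1// => i /negPf ->.
  rewrite n_fact -big_split; apply: eq_bigr => i _ /=.
  by rewrite -expnD subnK//; case: (i == j).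
have geom_m : \prod_i geom (p i)%:R^-1 (b i) < 2 :> R.
  rewrite -abundancy_prod// ltr_pdivrMr ?ltr0n// -natrM ltr_nat ltnNge.
  apply/negP => sigma_m; apply: (n_min m); first by rewrite n_m dvdn_mulr.
    rewrite n_m => /esym/eqP; rewrite -[X in _ == X]muln1 eqn_pmul2l//.
    by have := p0_min j; lia.
  exact/nondeficientE.
pose x i : R := (p i)%:R^-1.
have p_gt0 i : 0 < (p i)%:R :> R by rewrite ltr0n prime_gt0.
have x_gt0 i : 0 < x i by rewrite invr_gt0.
have x_le i : x i <= x ord0 by rewrite lef_pV2 ?posrE// ler_nat.
have x0_le : x ord0 <= 11^-1.
  by rewrite lef_pV2 ?posrE// (ler_nat R 11).
have x_ratio (u v : nat) i : (0 < u)%N -> (u * p ord0 <= v * p i)%N ->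
    x i <= v%:R / u%:R * x ord0.
  move=> u0 uv; rewrite -[x i]mul1r -mulrA -invfM ler_pdivrMr// mulrAC.
  rewrite ler_pdivlMr; last by rewrite mulr_gt0 // ltr0n.
  by rewrite mul1r -!natrM ler_nat.
(* As [p ord0 >= 11], [11 * (2 * p ord0 - 1) >= 21 * p ord0] and
   [11 * (3 * p ord0 - 4) >= 29 * p ord0]. *)
have xt_le : x t <= 11 / 21 * x ord0 by apply: x_ratio => //; lia.
have xj_le : x j <= 11 / 29 * x ord0 by apply: x_ratio => //; lia.
(* A positive even exponent is at least 2, so [b j] is still at least 1; the possibly simple
   exponent [a t] is untouched since [j != t]. *)
have b_ge i : (1 + (i != t) * (i != j) <= b i)%N.
  rewrite /b; have := a_ge1 i; have [->|it] := eqVneq i t.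
    by rewrite mul0n eq_sym (negPf jt); lia.
  by have := a_even _ it; case: (i == j) => /=; lia.
(* Correction to the linear term: a gain at [ord0], losses at [t] and [j], and zero elsewhere. The
   three indices are distinct. *)
pose c i := (i == ord0)%:R * (x ord0 ^+ 2 / 2 - 2 / 3 * x ord0 ^+ 3)
  - (i == t)%:R * (x t ^+ 2 / 2) - (i == j)%:R * (x j ^+ 2 / 2).
have ln_ge i : x i + c i <= ln (geom (x i) (b i)).
  have x_pos : 0 <= x i <= 11^-1 by rewrite ltW//= (le_trans (x_le i)).
  have := b_ge i; rewrite /c; have [->|it] := eqVneq i t.
    rewrite eq_sym in jt.
    rewrite (negPf t_neq0) (negPf jt) /= mul1r !mul0r => bt.
    by apply: le_trans (ln_geom_ge1 _ bt); have := x_gt0 t; have := xt_le; lra.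
  have [->|ij] := eqVneq i j.
    rewrite (negPf j_neq0) /= mul1r !mul0r => bj.
    by apply: le_trans (ln_geom_ge1 _ bj); have := x_gt0 j; have := xj_le; lra.
  move=> bi; apply: le_trans (ln_geom_ge2 x_pos bi).
  case: eqP => [->|_]; rewrite /= ?mul1r !mul0r; first by lra.
  (* At the remaining indices the surplus [x i ^+ 2 / 2 - 2 / 3 * x i ^+ 3] is nonnegative and is
     dropped. *)
  by have /andP[] := x_pos; nra.
have delta (l : 'I_k.+1) (y : R) : \sum_i (i == l)%:R * y = y.
  rewrite (bigD1 l)//= eqxx mul1r big1 ?addr0// => i /negPf ->.
  by rewrite mul0r.
have sum_c : \sum_i c i
    = x ord0 ^+ 2 / 2 - 2 / 3 * x ord0 ^+ 3 - x t ^+ 2 / 2 - x j ^+ 2 / 2.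
  by rewrite !big_split !sumrN !delta.
have geom_gt0 i : 0 < geom (x i) (b i).
  apply: lt_le_trans (geom_ge1Dx (ltW (x_gt0 i)) _).
    by have := x_gt0 i; lra.
  by apply: leq_trans (b_ge i).
have : \sum_i (x i + c i) < ln 2.
  apply: le_lt_trans (_ : ln (\prod_i geom (x i) (b i)) < _).
    by rewrite ln_prod//; apply: ler_sum => i _.
  by rewrite ltr_ln ?posrE// prodr_gt0.
rewrite big_split /= sum_c n_fact T_prod// -/x invfM mulrA -exprVn -/(x ord0).
have := quadratic_balance (x_gt0 ord0) (x_gt0 t) (x_gt0 j) x0_le xt_le xj_le.
by lra.
Qed.
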